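(* Let $s\ge1$ be an integer, let $(h_n)_{n\ge1}$ be reals with $0<h_n\le1$ and $h_n\to0$, let $X_1,X_2,\dots$ be independent real random variables with common density $f$ on $\mathbb{R}$, and let $K_{(0)},K_{(s)}\in\mathcal{B}_s$ satisfy $$\alpha_0(K_{(0)})=1,\quad \alpha_j(K_{(0)})=0\ \text{ for } j=1,\dots,s,\qquad \alpha_j(K_{(s)})=0\ \text{ for } j=0,1,\dots,s-1,\quad \alpha_s(K_{(s)})=1 .$$ Put $K_n=K_{(0)}+h_nK_{(s)}$ and $$\hat f_n(x)=\frac1n\sum_{j=1}^n(S_{h_n}K_n)(x-X_j),\qquad f_n^{(0)}(x)=\frac1n\sum_{j=1}^n(S_{h_n}K_{(0)})(x-X_j).$$ Then for every $n$, $$E\int|\hat f_n-f\ast S_{h_n}K_n|\le E\int|f_n^{(0)}-f\ast S_{h_n}K_{(0)}|+2h_n\int|f|\int|K_{(s)}| .$$ Moreover, if $f$ has a variance (i.e. $\int x^2f(x)\,dx<\infty$), $\int(1+t^2)(K_{(0)}(t))^2dt<\infty$, and there is a constant $c<\infty$ with $nh_n^3\le c$ for all $n$, then $$\sqrt{nh_n}\;E\int|\hat f_n-f\ast S_{h_n}K_n|=O(1)\quad\text{as } n\to\infty .$$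
   Context: All integrals are over $\mathbb{R}$ with respect to Lebesgue measure; $E$ denotes expectation. For a function $K$ on $\mathbb{R}$, $\alpha_j(K)=\int t^jK(t)\,dt$ and $\beta_m(K)=\int|t|^m|K(t)|\,dt$. $\mathcal{B}_s$ is the space of functions $K$ on $\mathbb{R}$ with finite norm $\|K\|_{\mathcal{B}_s}=\beta_0(K)+\beta_s(K)$. For $h>0$, $(S_hK)(x)=\frac1hK\left(\frac xh\right)$. Convolution is $(f\ast g)(x)=\int g(y)f(x-y)\,dy$. *)

(* Defs.v *)
From HB Require Import structures.
From mathcomp Require Import all_boot all_order all_algebra.
From mathcomp Require Import all_classical all_reals all_analysis.

Set Implicit Arguments.
Unset Strict Implicit.
Unset Printing Implicit Defensive.

Import Order.TTheory GRing.Theory Num.Theory.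
Import numFieldNormedType.Exports.

Local Open Scope classical_set_scope.
Local Open Scope ring_scope.
Local Open Scope ereal_scope.

(* Extended-real valued; every use below is for K in B_s and j <= s, where the
   integrand is integrable since |t|^j <= 1 + |t|^s. *)
Definition alpha (R : realType) (j : nat) (K : R -> R) : \bar R :=
  \int[@lebesgue_measure R]_t (t ^+ j * K t)%:E.

Definition beta (R : realType) (m : nat) (K : R -> R) : \bar R :=
  \int[@lebesgue_measure R]_t (`|t| ^+ m * `|K t|)%:E.

Definition B_norm (R : realType) (s : nat) (K : R -> R) : \bar R :=
  beta 0 K + beta s K.

(* Elements of B_s are represented by Borel functions; all the integrals depend
   on K only up to equality almost everywhere. *)
Definition in_B (R : realType) (s : nat) (K : R -> R) : Prop :=
  measurable_fun [set: R] K /\ B_norm s K < +oo.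

(* (S_h K)(x) = K(x/h)/h *)
Definition dilate (R : realType) (h : R) (K : R -> R) : R -> R :=
  fun x => (h^-1 * K (x / h))%R.

(* For integrable f and g the integral converges for almost every x; at the
   remaining x the real-valued integral takes a default value, which is
   immaterial under integration in x. *)
Definition convolution (R : realType) (f g : R -> R) : R -> R :=
  fun x => (\int[@lebesgue_measure R]_y (g y * f (x - y)))%R.

(* Mutual independence: the product rule over every finite set J of indices. *)
Definition mutually_independent d (T : measurableType d) (R : realType)
    (P : probability T R) (X : nat -> {RV P >-> R}) : Prop :=
  forall (J : seq nat) (A : nat -> set R), uniq J ->
    (forall j, measurable (A j)) ->
    P (\bigcap_(j in [set` J]) (X j @^-1` A j)) =
      \prod_(j <- J) P (X j @^-1` A j).

Definition has_density d (T : measurableType d) (R : realType)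
    (P : probability T R) (Y : {RV P >-> R}) (f : R -> R) : Prop :=
  [/\ measurable_fun [set: R] f,
      forall x, (0 <= f x)%R
    & forall A : set R, measurable A ->
        distribution P Y A = \int[@lebesgue_measure R]_(x in A) (f x)%:E].

(* The sample X_1, ..., X_n is X 0, ..., X n.-1. *)
Definition kernel_estimator (T : Type) (R : realType) (X : nat -> T -> R)
    (K : R -> R) (h : R) (n : nat) (w : T) (x : R) : R :=
  (n%:R^-1 * \sum_(j < n) dilate h K (x - X j w))%R.

(* E \int |f_n - f * S_h K|, where f_n is the kernel estimator; an iterated
   integral of a nonnegative function, with values in [0, +oo]. *)
Definition L1_deviation d (T : measurableType d) (R : realType)
    (P : probability T R) (X : nat -> {RV P >-> R}) (f K : R -> R)
    (h : R) (n : nat) : \bar R :=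
  \int[P]_w \int[@lebesgue_measure R]_x
    `| kernel_estimator X K h n w x - convolution f (dilate h K) x |%:E.

(* Main.v *)
Require Import Defs.
From HB Require Import structures.
From mathcomp Require Import all_boot all_order all_algebra ring lra.
From mathcomp Require Import all_classical all_reals all_analysis measurable_realfun.

Set Implicit Arguments.
Unset Strict Implicit.
Unset Printing Implicit Defensive.

Import Order.TTheory GRing.Theory Num.Theory.
Import numFieldNormedType.Exports.

Local Open Scope classical_set_scope.
Local Open Scope ring_scope.
Local Open Scope ereal_scope.

(** The estimator and the convolution are both linear in the kernel, so the
    deviation for K0 + h Ks is at most the one for K0 plus h times the one for
    Ks.  The L1 norms of the estimator and of the convolution built from Ks are
    each at most the L1 norm of Ks, because dilations and translations preserve
    L1 norms and f integrates to 1; this gives the error term 2 h |f|_1 |Ks|_1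
    ([L1_deviationD_le]).  Linearity of the convolution holds at almost every
    point only, where both convolution integrals converge.

    For the rate, sqrt(n h) h = sqrt(n h^3) is bounded, so the error term is
    harmless and only K0 matters.  The key identity is that the convolution at x
    is the expectation of S_h K0 (x - X_0) ([convolution_expectation]): the
    deviation at x is that of a sample mean of independent, identically
    distributed variables from its expectation, and its mean square is at most
    E (S_h K0 (x - X_0))^2 / n ([sample_mean_variance_le]).  Instead of the
    inequalities of Jensen and Cauchy-Schwarz, a single weighted inequality
    between arithmetic and geometric means,
      sqrt(n h) |D| <= ((1 + x^2) n h D^2 + 1 / (1 + x^2)) / 2,
    turns the L1 deviation into a weighted L2 deviation plus a constant
    ([expectation_deviation_le]).  After the substitution x = X_0 + h u the
    weighted second moment is E of the integral of (1 + (X_0 + h u)^2) K0(u)^2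
    in u, and for h <= 1 the weight is at most 2 (1 + X_0^2) (1 + u^2), which
    separates the variance of f from the weighted L2 norm of K0
    ([integral_weighted_shift_le]). *)

(** * Change of variables *)

(** Two densities of nu with respect to mu agree almost everywhere, so f can
    replace the Radon-Nikodym derivative, for which the formula is known. *)
Lemma ge0_integral_density d (T : measurableType d) (R : realType)
    (mu : {sigma_finite_measure set T -> \bar R})
    (nu : {finite_measure set T -> \bar R}) (f : T -> R) (G : T -> \bar R) :
  measurable_fun [set: T] f -> (forall x, (0 <= f x)%R) ->
  (forall A, measurable A -> nu A = \int[mu]_(x in A) (f x)%:E) ->
  measurable_fun [set: T] G -> (forall x, 0 <= G x) ->
  \int[nu]_x G x = \int[mu]_x (G x * (f x)%:E).
Proof.
move=> mf f0 nuE mG G0.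
have dom : nu `<< mu.
  apply/null_content_dominatesP => A mA mA0.
  by rewrite nuE// null_set_integral//; exact/measurable_EFinP/measurable_funTS.
rewrite -(Radon_Nikodym_SigmaFinite.change_of_variables dom)//.
have mRN : measurable_fun [set: T]
    (Radon_Nikodym_SigmaFinite.f nu mu).
  exact: (measurable_int _ (Radon_Nikodym_SigmaFinite.f_integrable dom)).
apply: ge0_ae_eq_integral => //.
- exact: emeasurable_funM.
- by apply: emeasurable_funM => //; exact/measurable_EFinP.
- by move=> x _; rewrite mule_ge0// Radon_Nikodym_SigmaFinite.f_ge0.
- by move=> x _; rewrite mule_ge0// lee_fin.
apply: ae_eqe_mul2l; apply: integral_ae_eq => //.
- exact: Radon_Nikodym_SigmaFinite.f_integrable.
- exact/measurable_EFinP.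
- by move=> A _ mA; rewrite -nuE// -Radon_Nikodym_SigmaFinite.f_integral.
Qed.

Lemma measurable_affine (R : realType) (a b : R) :
  measurable_fun [set: R] (fun x : R => (a * x + b)%R).
Proof. by apply: measurable_funD => //; exact: measurable_funM. Qed.

(** By uniqueness of Lebesgue measure it is enough to compare half-open
    intervals: their preimages under the affine map are intervals whose length
    is divided by |a|.  A negative a swaps the open and the closed end. *)
Lemma ge0_integral_affine (R : realType) (a b : R) (G : R -> \bar R) :
  a != 0%R -> measurable_fun [set: R] G -> (forall x, 0 <= G x) ->
  \int[@lebesgue_measure R]_x G (a * x + b)%R =
    (`|a|^-1)%:E * \int[@lebesgue_measure R]_x G x.
Proof.
move=> a0 mG G0.
pose phi : measurableTypeR R -> measurableTypeR R := fun x => (a * x + b)%R.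
have mphi : measurable_fun setT phi by exact: measurable_affine.
have an : (0 < `|a|)%R by rewrite normr_gt0.
pose m0 := mscale (NngNum (normr_ge0 a)) (pushforward (@lebesgue_measure R) phi).
pose m := m0 mphi.
have mE (A : set R) : measurable A -> @lebesgue_measure R A = m A.
  apply: lebesgue_measure_unique => _ [[u v]] _ <-.
  change (lebesgue_measure `]u, v] =
    `|a|%:E * lebesgue_measure (phi @^-1` `]u, v])).
  move: a0; rewrite neq_lt => /orP[a0|a0].
    have -> : phi @^-1` `]u, v] = `[((v - b) / a)%R, ((u - b) / a)%R[%classic.
      apply/seteqP; split => x /=; rewrite !in_itv/= /phi ler_ndivrMr// ltr_ndivlMr//.
        by move=> /andP[? ?]; apply/andP; split; lra.
      by move=> /andP[? ?]; apply/andP; split; lra.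
    rewrite !lebesgue_measure_itv/= !lte_fin ltr_ndivrMr// divfK ?lt_eqF//.
    rewrite ltrD2r; case: ifPn => // uv; last by rewrite mule0.
    rewrite ltr0_norm// -EFinB -EFinM; congr EFin; field.
    by rewrite lt_eqF.
  have -> : phi @^-1` `]u, v] = `]((u - b) / a)%R, ((v - b) / a)%R]%classic.
    apply/seteqP; split => x /=; rewrite !in_itv/= /phi ltr_pdivrMr// ler_pdivlMr//.
      by move=> /andP[? ?]; apply/andP; split; lra.
    by move=> /andP[? ?]; apply/andP; split; lra.
  rewrite !lebesgue_measure_itv/= !lte_fin ltr_pdivrMr// divfK ?gt_eqF//.
  rewrite ltrD2r; case: ifPn => // uv; last by rewrite mule0.
  rewrite gtr0_norm// -EFinB -EFinM; congr EFin; field.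
  by rewrite gt_eqF.
rewrite [in RHS](eq_measure_integral m); last by move=> A mA _; exact: mE.
rewrite ge0_integral_mscale//= muleA -EFinM mulVf ?gt_eqF// mul1e.
by rewrite ge0_integral_pushforward.
Qed.

(** * Convolution with a density *)

(** The integral of a signed function is by definition the difference of those
    of its positive and negative parts, whether or not it converges, and
    Tonelli's theorem applies to each part. *)
Lemma measurable_integral_EFin d1 d2 (T1 : measurableType d1)
    (T2 : measurableType d2) (R : realType)
    (m : {sigma_finite_measure set T2 -> \bar R}) (F : T1 * T2 -> R) :
  measurable_fun [set: T1 * T2] F ->
  measurable_fun [set: T1] (fun x => \int[m]_y (F (x, y))%:E).
Proof.
move=> mF.
have mE : measurable_fun [set: T1 * T2] (EFin \o F) by exact/measurable_EFinP.
rewrite (_ : (fun x => _) = fubini_F m (EFin \o F)^\+ \- fubini_F m (EFin \o F)^\-).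
  apply: emeasurable_funB; apply: measurable_fun_fubini_tonelli_F => //.
    exact: measurable_funepos.
  exact: measurable_funeneg.
apply/funext => x; rewrite integralE; congr (_ - _).
  by apply: eq_integral => y _; rewrite !funeposE.
by apply: eq_integral => y _; rewrite !funenegE.
Qed.

Section convolution.
Context d (T : measurableType d) (R : realType) (P : probability T R).
Context (Y : {RV P >-> R}) (f : R -> R) (Yf : has_density Y f).
Local Notation mu := (@lebesgue_measure R).

(** [Y'] is [Y] with values in the copy of the real line that carries Lebesgue
    measure: the two sigma-algebras have the same sets, but are distinct
    structures. *)
Lemma ge0_expectation_density (G : R -> \bar R) :
  measurable_fun [set: R] G -> (forall y, 0 <= G y) ->
  \int[P]_w G (Y w) = \int[mu]_z (G z * (f z)%:E).
Proof.
move=> mG G0; have [mf f0 fE] := Yf.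
pose Y' : {mfun T >-> measurableTypeR R} :=
  HB.pack (Y : T -> measurableTypeR R)
    (isMeasurableFun.Build _ _ _ (measurableTypeR R) _ (@measurable_funPT _ _ _ _ Y)).
transitivity (\int[distribution P Y']_z G z).
  by rewrite ge0_integral_distribution.
by rewrite (ge0_integral_density (mu := mu) (nu := distribution P Y') mf f0 fE).
Qed.

(** The reflection y = x - z exchanges the two factors of a convolution. *)
Lemma ge0_convolution_expectation (G : R -> \bar R) x :
  measurable_fun [set: R] G -> (forall y, 0 <= G y) ->
  \int[mu]_y (G y * (f (x - y))%:E) = \int[P]_w G (x - Y w)%R.
Proof.
move=> mG G0; have [mf f0 fE] := Yf.
have mGx : measurable_fun [set: R] (fun z => G (x - z)%R).
  by apply: measurableT_comp => //; exact: measurable_funB.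
rewrite (ge0_expectation_density mGx)//.
pose H y := G y * (f (x - y))%:E.
have mH : measurable_fun [set: R] H.
  apply: emeasurable_funM => //; apply/measurable_EFinP.
  by apply: measurableT_comp => //; exact: measurable_funB.
transitivity (\int[mu]_z H (-1 * z + x)%R).
  rewrite (ge0_integral_affine _ _ mH) ?oppr_eq0//.
    by rewrite normrN1 invr1 mul1e.
  by move=> y; rewrite mule_ge0// lee_fin.
by apply: eq_integral => z _; rewrite /H; congr (G _ * (f _)%:E); ring.
Qed.

(** The positive and negative parts correspond separately, so both sides take
    the same default value when the integral diverges. *)
Lemma convolution_expectation (k : R -> R) x : measurable_fun [set: R] k ->
  convolution f k x = fine (\int[P]_w (k (x - Y w))%:E).
Proof.
move=> mk; have [mf f0 fE] := Yf.
have mE : measurable_fun [set: R] (EFin \o k) by exact/measurable_EFinP.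
rewrite /convolution /Rintegral [in LHS]integralE [in RHS]integralE.
congr (fine (_ - _)).
- transitivity (\int[P]_w (EFin \o k)^\+ (x - Y w)%R); last first.
    by apply: eq_integral => w _; rewrite !funeposE.
  rewrite -ge0_convolution_expectation//; last exact: measurable_funepos.
  apply: eq_integral => y _; rewrite !funeposE maxe_pMl ?lee_fin//.
  by rewrite mul0e EFinM.
- transitivity (\int[P]_w (EFin \o k)^\- (x - Y w)%R); last first.
    by apply: eq_integral => w _; rewrite !funenegE.
  rewrite -ge0_convolution_expectation//; last exact: measurable_funeneg.
  apply: eq_integral => y _; rewrite !funenegE maxe_pMl ?lee_fin//.
  by rewrite mul0e mulNe EFinM.
Qed.

Lemma measurable_shift (k : R -> R) : measurable_fun [set: R] k ->
  measurable_fun [set: measurableTypeR R * T]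
    (fun z : measurableTypeR R * T => k (z.1 - Y z.2)%R).
Proof.
move=> mk; apply: (measurableT_comp mk); apply: measurable_funB => //.
by apply: measurableT_comp.
Qed.

Lemma measurable_convolution (k : R -> R) : measurable_fun [set: R] k ->
  measurable_fun [set: R] (convolution f k).
Proof.
move=> mk; rewrite (_ : convolution f k = fun x =>
    fine (\int[P]_w (k (x - Y w))%:E)); last first.
  by apply/funext => x; exact: convolution_expectation.
apply: measurableT_comp => //.
exact: (measurable_integral_EFin _ (measurable_shift mk)).
Qed.

Lemma integral_translation (k : R -> R) y : measurable_fun [set: R] k ->
  \int[mu]_x `|k (x - y)|%:E = \int[mu]_x `|k x|%:E.
Proof.
move=> mk.
have mn : measurable_fun [set: R] (fun x => `|k x|%:E).
  by apply/measurable_EFinP; apply: measurableT_comp.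
have := @ge0_integral_affine R 1 (- y) (fun x => `|k x|%:E).
rewrite oner_eq0 => /(_ isT mn) /=; rewrite normr1 invr1 mul1e => <-//.
by apply: eq_integral => x _; rewrite mul1r.
Qed.

(** Tonelli: the integral over x of |k (x - y)| is the same for every value y
    of [Y], and P has mass 1. *)
Lemma integral_shift (k : R -> R) : measurable_fun [set: R] k ->
  \int[mu]_x \int[P]_w `|k (x - Y w)|%:E = \int[mu]_x `|k x|%:E.
Proof.
move=> mk.
rewrite (fubini_tonelli (fun z : measurableTypeR R * T => `|k (z.1 - Y z.2)|%:E))//=.
  transitivity (\int[P]_w (cst (\int[mu]_x `|k x|%:E) w)).
    by apply: eq_integral => w _; exact: integral_translation.
  by rewrite integral_cst//= probability_setT mule1.
apply/measurable_EFinP; apply: measurableT_comp => //.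
exact: measurable_shift.
Qed.

Lemma abs_fine_le (a : \bar R) : `|fine a|%:E <= `|a|.
Proof. by case: a => [r| |]//=; rewrite normr0 leey. Qed.

(** Integrate |E k (x - Y)| <= E |k (x - Y)| over x: Young's inequality for a
    probability density. *)
Lemma integral_abs_convolution_le (k : R -> R) : measurable_fun [set: R] k ->
  \int[mu]_x `|convolution f k x|%:E <= \int[mu]_x `|k x|%:E.
Proof.
move=> mk; rewrite -(integral_shift mk); apply: ge0_le_integral => //.
- apply/measurable_EFinP; apply: measurableT_comp => //.
  exact: measurable_convolution.
- have : measurable_fun [set: measurableTypeR R * T]
      (fun z : measurableTypeR R * T => `|k (z.1 - Y z.2)%R|%R).
    by apply: measurableT_comp => //; exact: measurable_shift.
  exact: measurable_integral_EFin.
move=> x _; rewrite convolution_expectation//.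
apply: (le_trans (abs_fine_le _)); apply: le_abse_integral => //.
apply/measurable_EFinP; apply: (measurableT_comp mk); exact: measurable_funB.
Qed.

(** The integral of E |k (x - Y)| over x is finite, hence its integrand is
    finite almost everywhere. *)
Lemma ae_integrable_shift (k : R -> R) : measurable_fun [set: R] k ->
  \int[mu]_x `|k x|%:E < +oo ->
  {ae mu, forall x, P.-integrable [set: T] (fun w => (k (x - Y w))%:E)}.
Proof.
move=> mk kfin.
apply: (@ae_integrable1 _ _ _ _ _ mu P
  (fun z : measurableTypeR R * T => (k (z.1 - Y z.2))%:E)).
have mF := measurable_shift mk.
apply/integrable12ltyP; first exact/measurable_EFinP.
by under eq_integral do rewrite /=; rewrite integral_shift.
Qed.

Lemma ae_convolutionD (k1 k2 : R -> R) (c : R) :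
  measurable_fun [set: R] k1 -> measurable_fun [set: R] k2 ->
  \int[mu]_x `|k1 x|%:E < +oo -> \int[mu]_x `|k2 x|%:E < +oo ->
  {ae mu, forall x, convolution f (fun t => k1 t + c * k2 t)%R x =
    (convolution f k1 x + c * convolution f k2 x)%R}.
Proof.
move=> mk1 mk2 k1fin k2fin.
have := ae_integrable_shift mk2 k2fin; have := ae_integrable_shift mk1 k1fin.
apply: filterS2; first exact: (ae_filter_ringOfSetsType mu).
move=> x i1 i2; rewrite !convolution_expectation//; last first.
  by apply: measurable_funD => //; exact: measurable_funM.
under eq_integral do rewrite EFinD EFinM.
rewrite integralD//; last exact: integrableZl.
rewrite integralZl// fineD ?fineM//; first exact: integrable_fin_num.
  exact: integrable_fin_num.
by rewrite fin_numM//; exact: integrable_fin_num.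
Qed.

End convolution.

Lemma measurable_dilate (R : realType) (h : R) (k : R -> R) :
  measurable_fun [set: R] k -> measurable_fun [set: R] (dilate h k).
Proof.
move=> mk; apply: measurable_funM => //; apply: (measurableT_comp mk).
exact: measurable_funM.
Qed.

Lemma integral_abs_dilate (R : realType) (h : R) (k : R -> R) : (0 < h)%R ->
  measurable_fun [set: R] k ->
  \int[@lebesgue_measure R]_x `|dilate h k x|%:E =
  \int[@lebesgue_measure R]_x `|k x|%:E.
Proof.
move=> h0 mk.
have mn : measurable_fun [set: R] (fun x => `|k x|%:E).
  by apply/measurable_EFinP; apply: measurableT_comp.
have mnh : measurable_fun [set: R] (fun x => `|k (h^-1 * x + 0)|%:E).
  by apply: (measurableT_comp mn); exact: measurable_affine.
transitivity (\int[@lebesgue_measure R]_x (h^-1%:E * `|k (h^-1 * x + 0)|%:E)).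
  apply: eq_integral => x _; rewrite /dilate normrM gtr0_norm ?invr_gt0//.
  by rewrite EFinM addr0 mulrC.
rewrite ge0_integralZl//; last by rewrite lee_fin invr_ge0 ltW.
rewrite (ge0_integral_affine 0 _ mn)//; last by rewrite invr_eq0 gt_eqF.
by rewrite muleA -EFinM gtr0_norm ?invr_gt0// invrK mulVf ?mul1e// gt_eqF.
Qed.

(** * The L1 deviation as a function of the kernel *)

Lemma in_B_integral (R : realType) (s : nat) (K : R -> R) : in_B s K ->
  \int[@lebesgue_measure R]_x `|K x|%:E < +oo.
Proof.
move=> [mK]; apply: le_lt_trans; rewrite /B_norm /beta.
under [X in X + _]eq_integral do rewrite expr0 mul1r.
by rewrite leeDl// integral_ge0.
Qed.

Section L1_deviation.
Context d (T : measurableType d) (R : realType) (P : probability T R).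
Context (X : nat -> {RV P >-> R}) (f : R -> R).
Context (Xf : forall j, has_density (X j) f).
Local Notation mu := (@lebesgue_measure R).

Lemma measurable_estimator (K : R -> R) (h : R) n : measurable_fun [set: R] K ->
  measurable_fun [set: T * measurableTypeR R]
    (fun z : T * measurableTypeR R => kernel_estimator X K h n z.1 z.2).
Proof.
move=> mK; apply: measurable_funM => //; apply: measurable_sum => j.
apply: (measurableT_comp (measurable_dilate h mK)); apply: measurable_funB => //.
exact: measurableT_comp.
Qed.

Lemma measurable_deviation (K : R -> R) (h : R) n : measurable_fun [set: R] K ->
  measurable_fun [set: T * measurableTypeR R]
    (fun z : T * measurableTypeR R => `|kernel_estimator X K h n z.1 z.2 -
       convolution f (dilate h K) z.2|%R).
Proof.
move=> mK; apply: measurableT_comp => //.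
apply: measurable_funB; first exact: measurable_estimator.
apply: measurableT_comp => //; apply: (measurable_convolution (Xf 0)).
exact: measurable_dilate.
Qed.

Lemma integral_abs_estimator_le (K : R -> R) (h : R) n w :
  (0 < h)%R -> measurable_fun [set: R] K ->
  \int[mu]_x `|kernel_estimator X K h n w x|%:E <= \int[mu]_x `|K x|%:E.
Proof.
move=> h0 mK; have mD := measurable_dilate h mK.
have mDj j : measurable_fun [set: R] (fun x => dilate h K (x - X j w)).
  by apply: (measurableT_comp mD); exact: measurable_funB.
have mDj' j : measurable_fun [set: R] (fun x => `|dilate h K (x - X j w)|%:E).
  by apply/measurable_EFinP; exact: measurableT_comp.
have mS : measurable_fun [set: R]
    (fun x => \sum_(j < n) `|dilate h K (x - X j w)|%:E).
  exact: emeasurable_sum.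
apply: (@le_trans _ _ (\int[mu]_x
    ((n%:R^-1)%:E * \sum_(j < n) `|dilate h K (x - X j w)|%:E))).
  apply: ge0_le_integral => //.
  - apply/measurable_EFinP; apply: measurableT_comp => //.
    by apply: measurable_funM => //; apply: measurable_sum => j; exact: mDj.
  - exact: measurable_funeM.
  move=> x _; rewrite sumEFin -EFinM lee_fin /kernel_estimator normrM.
  by rewrite ger0_norm ?invr_ge0// ler_wpM2l ?invr_ge0// ler_norm_sum.
rewrite ge0_integralZl//; last by move=> x _; exact: sume_ge0.
rewrite ge0_integral_sum//; last by move=> j; exact: mDj'.
under eq_bigr do rewrite integral_translation// integral_abs_dilate//.
have [I0 | I1] := eqVneq (\int[mu]_x `|K x|%:E) +oo; first by rewrite I0 leey.
have : \int[mu]_x `|K x|%:E \is a fin_num.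
  by rewrite ge0_fin_numE ?integral_ge0// lt_neqAle I1 leey.
move=> /fineK IE; have : 0 <= \int[mu]_x `|K x|%:E by exact: integral_ge0.
rewrite -IE lee_fin sumEFin sumr_const card_ord -EFinM lee_fin => I0.
rewrite -[X in (_ * X)%R]mulr_natl mulrA; case: n {mS} => [|n]; first by rewrite mulr0 mul0r.
by rewrite mulVf ?mul1r// pnatr_eq0.
Qed.

Lemma dilateD (h c : R) (K1 K2 : R -> R) :
  dilate h (fun t => K1 t + c * K2 t)%R =
  (fun t => dilate h K1 t + c * dilate h K2 t)%R.
Proof. by apply/funext => t; rewrite /dilate mulrDr mulrCA. Qed.

Lemma kernel_estimatorD (h c : R) (K1 K2 : R -> R) n w x :
  kernel_estimator X (fun t => K1 t + c * K2 t)%R h n w x =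
  (kernel_estimator X K1 h n w x + c * kernel_estimator X K2 h n w x)%R.
Proof.
rewrite /kernel_estimator dilateD big_split/= mulrDr; congr (_ + _)%R.
by rewrite [RHS]mulrCA [in RHS]mulr_sumr.
Qed.

(** Pathwise form of the comparison: it holds for each sample, before
    expectations are taken. *)
Lemma integral_deviationD_le (h c : R) (K1 K2 : R -> R) n w :
  (0 < h)%R -> (0 <= c)%R ->
  measurable_fun [set: R] K1 -> measurable_fun [set: R] K2 ->
  \int[mu]_x `|K1 x|%:E < +oo -> \int[mu]_x `|K2 x|%:E < +oo ->
  \int[mu]_x `|kernel_estimator X (fun t => K1 t + c * K2 t)%R h n w x -
     convolution f (dilate h (fun t => K1 t + c * K2 t)%R) x|%:E <=
  \int[mu]_x `|kernel_estimator X K1 h n w x -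
     convolution f (dilate h K1) x|%:E + (2 * c)%:E * \int[mu]_x `|K2 x|%:E.
Proof.
move=> h0 c0 mK1 mK2 iK1 iK2; pose K t := (K1 t + c * K2 t)%R; rewrite -/K.
have mK : measurable_fun [set: R] K.
  by apply: measurable_funD => //; exact: measurable_funM.
have msec k : measurable_fun [set: R] k -> measurable_fun [set: R]
    (fun x => `|kernel_estimator X k h n w x - convolution f (dilate h k) x|%:E).
  move=> mk; apply/measurable_EFinP.
  exact: (measurable_fun_pair2 w (measurable_deviation h n mk)).
have mE : measurable_fun [set: R] (fun x => `|kernel_estimator X K2 h n w x|%:E).
  apply/measurable_EFinP; apply: measurableT_comp => //.
  exact: (measurable_fun_pair2 w (measurable_estimator h n mK2)).
have mD2 := measurable_dilate h mK2.
have mC : measurable_fun [set: R] (fun x => `|convolution f (dilate h K2) x|%:E).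
  apply/measurable_EFinP; apply: measurableT_comp => //.
  exact: (measurable_convolution (Xf 0)).
apply: (@le_trans _ _ (\int[mu]_x (`|kernel_estimator X K1 h n w x -
     convolution f (dilate h K1) x|%:E +
     c%:E * (`|kernel_estimator X K2 h n w x|%:E +
             `|convolution f (dilate h K2) x|%:E)))).
  apply: ae_ge0_le_integral => //.
  - exact: msec.
  - by move=> x _; rewrite adde_ge0// mule_ge0// ?adde_ge0.
  - apply: emeasurable_funD; first exact: msec.
    by apply: measurable_funeM; exact: emeasurable_funD.
  have := ae_convolutionD (Xf 0) c (measurable_dilate h mK1) mD2.
  rewrite !integral_abs_dilate// => /(_ iK1 iK2).
  apply: filterS; first exact: (ae_filter_ringOfSetsType mu).
  move=> x convE _; rewrite kernel_estimatorD dilateD convE.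
  rewrite -[X in c%:E * X]EFinD -EFinM -EFinD lee_fin.
  set e1 := kernel_estimator X K1 _ _ _ _; set e2 := kernel_estimator X K2 _ _ _ _.
  set g1 := convolution _ _ _; set g2 := convolution _ _ _.
  rewrite (_ : _ - _ = (e1 - g1) + c * (e2 - g2))%R; last by ring.
  rewrite (le_trans (ler_normD _ _))// lerD2l normrM (ger0_norm c0).
  by rewrite ler_wpM2l// ler_normB.
rewrite ge0_integralD//; last 3 first.
- exact: msec.
- by move=> x _; rewrite mule_ge0// ?adde_ge0.
- by apply: measurable_funeM; exact: emeasurable_funD.
rewrite leeD2l// ge0_integralZl//; last 2 first.
- exact: emeasurable_funD.
- by move=> x _; rewrite adde_ge0.
rewrite ge0_integralD// mulrC EFinM -muleA lee_wpmul2l ?lee_fin//.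
rewrite (_ : 2%:E = 1 + 1)// ge0_muleDl// mul1e; apply: leeD.
  exact: integral_abs_estimator_le.
by rewrite -(integral_abs_dilate h0 mK2) (integral_abs_convolution_le (Xf 0)).
Qed.

Lemma measurable_integral_deviation (h : R) (K : R -> R) n :
  measurable_fun [set: R] K -> measurable_fun [set: T] (fun w =>
    \int[mu]_x `|kernel_estimator X K h n w x - convolution f (dilate h K) x|%:E).
Proof.
by move=> mK; exact: (measurable_integral_EFin _ (measurable_deviation h n mK)).
Qed.

(** Adding c K2 to a kernel costs at most c |K2|_1 for the estimator and
    c |K2|_1 for the convolution. *)
Lemma L1_deviationD_le (h c : R) (K1 K2 : R -> R) n :
  (0 < h)%R -> (0 <= c)%R ->
  measurable_fun [set: R] K1 -> measurable_fun [set: R] K2 ->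
  \int[mu]_x `|K1 x|%:E < +oo -> \int[mu]_x `|K2 x|%:E < +oo ->
  L1_deviation X f (fun t => K1 t + c * K2 t)%R h n <=
  L1_deviation X f K1 h n + (2 * c)%:E * \int[mu]_x `|K2 x|%:E.
Proof.
move=> h0 c0 mK1 mK2 iK1 iK2.
have mK : measurable_fun [set: R] (fun t => K1 t + c * K2 t)%R.
  by apply: measurable_funD => //; exact: measurable_funM.
have cI0 : 0 <= (2 * c)%:E * \int[mu]_x `|K2 x|%:E.
  by rewrite mule_ge0 ?lee_fin ?mulr_ge0 ?integral_ge0.
set b := (2 * c)%:E * _ in cI0 *.
apply: (@le_trans _ _ (\int[P]_w (\int[mu]_x `|kernel_estimator X K1 h n w x -
     convolution f (dilate h K1) x|%:E + cst b w))).
  apply: ge0_le_integral => //.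
  - by move=> w _; exact: integral_ge0.
  - exact: measurable_integral_deviation.
  - by apply: emeasurable_funD => //; exact: measurable_integral_deviation.
  by move=> w _; exact: integral_deviationD_le.
rewrite ge0_integralD//; last 2 first.
- by move=> w _; exact: integral_ge0.
- exact: measurable_integral_deviation.
by rewrite integral_cst//= probability_setT mule1.
Qed.

Lemma integral_density : \int[mu]_x `|f x|%:E = 1.
Proof.
have [mf f0 fE] := Xf 0; transitivity (\int[mu]_x (f x)%:E).
  by apply: eq_integral => x _; rewrite ger0_norm.
by rewrite -fE// probability_setT.
Qed.

End L1_deviation.

(** * Uncorrelated sums *)

Section variance.
Context d (T : measurableType d) (R : realType) (P : probability T R).

(** The product rule on rectangles makes the joint law the product of the
    marginal laws; Fubini's theorem then factors the integral of the product of
    the coordinates. *)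
Lemma independent_expectationM (Y Z : {RV P >-> R}) :
  (forall A B : set R, measurable A -> measurable B ->
     P (Y @^-1` A `&` Z @^-1` B) = P (Y @^-1` A) * P (Z @^-1` B)) ->
  (Y : T -> R) \in Lfun P 1 -> (Z : T -> R) \in Lfun P 1 ->
  (Y * Z : T -> R)%R \in Lfun P 1 ->
  'E_P[Y * Z] = 'E_P[Y] * 'E_P[Z].
Proof.
move=> YZ /Lfun1_integrable iY /Lfun1_integrable iZ /Lfun1_integrable iYZ.
pose W (w : T) : R * R := (Y w, Z w).
have mW : measurable_fun [set: T] W by exact: measurable_fun_pair.
pose W' : {mfun T >-> (R * R)%type} :=
  HB.pack W (isMeasurableFun.Build _ _ _ _ _ mW).
pose m := distribution P W'.
pose g (z : R * R) : \bar R := (z.1 * z.2)%:E.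
have mg : measurable_fun [set: R * R] g.
  by apply/measurable_EFinP; exact: measurable_funM.
have prodE A : measurable A ->
    (distribution P Y \x distribution P Z) A = m A.
  by apply: product_measure_unique => B C mB mC; exact: YZ.
have ig : (distribution P Y \x distribution P Z).-integrable [set: R * R] g.
  apply/integrableP; split => //.
  rewrite (eq_measure_integral (m)); last by move=> A mA _; exact: prodE.
  have /integrableP[] : (m).-integrable [set: R * R] g by exact: integrable_pushforward.
  by [].
rewrite unlock.
transitivity (\int[m]_z g z); first by rewrite integral_pushforward.
rewrite (eq_measure_integral (distribution P Y \x distribution P Z)); last first.
  by move=> A mA _; exact/esym/prodE.
rewrite -(integral12_prod_meas1 ig) /fubini_F /g /=.
have iY' : (distribution P Y).-integrable [set: R] EFin.
  by apply: integrable_pushforward => //; exact/measurable_EFinP.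
have iZ' : (distribution P Z).-integrable [set: R] EFin.
  by apply: integrable_pushforward => //; exact/measurable_EFinP.
have EY : \int[distribution P Y]_x x%:E = \int[P]_w (Y w)%:E.
  exact: (integral_distribution (X := Y) (f := EFin)).
have EZ : \int[distribution P Z]_x x%:E = \int[P]_w (Z w)%:E.
  exact: (integral_distribution (X := Z) (f := EFin)).
rewrite -EY -EZ.
have Zfin : \int[distribution P Z]_x x%:E \is a fin_num.
  exact: (integrable_fin_num _ iZ').
rewrite -(fineK Zfin) muleC -integralZl//.
apply: eq_integral => x _; under eq_integral do rewrite EFinM.
by rewrite integralZl// (fineK Zfin) muleC.
Qed.

(** Each new term is uncorrelated with the sum of the previous ones, by
    bilinearity of the covariance. *)
Lemma variance_sum_uncorrelated (Z : nat -> T -> R) n :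
  (forall j, Z j \in Lfun P 2%:E) ->
  (forall i j, i <> j -> covariance P (Z i) (Z j) = 0) ->
  'V_P[(\sum_(j < n) Z j)%R] = \sum_(j < n) 'V_P[Z j].
Proof.
move=> Z2 Z0.
have S2 m : (\sum_(j < m) Z j)%R \in Lfun P 2%:E.
  by rewrite rpred_sum ?lee1n// => j _; exact: Z2.
have covS m k : (m <= k)%N -> covariance P (\sum_(j < m) Z j)%R (Z k) = 0.
  elim: m => [|m IH] mk; first by rewrite big_ord0 covariance_cst_l.
  rewrite big_ord_recr covarianceDl// IH 1?ltnW// add0e Z0//.
  by apply/eqP; rewrite ltn_eqF.
elim: n => [|n IH]; first by rewrite !big_ord0 variance_cst.
by rewrite !big_ord_recr varianceD// IH covS// mule0 adde0.
Qed.

End variance.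

(** * Mean square error of a sample mean *)

Lemma Lfun2_integral_sqr d (T : measurableType d) (R : realType)
    (m : {measure set T -> \bar R}) (f : T -> R) :
  measurable_fun [set: T] f -> \int[m]_x (f x ^+ 2)%:E < +oo ->
  f \in Lfun m 2%:E.
Proof.
move=> mf f2; rewrite inE; apply/andP; split; rewrite inE//=.
rewrite /finite_norm unlock poweR_lty//.
apply: le_lt_trans f2; rewrite le_eqVlt; apply/orP; left; apply/eqP.
by apply: eq_integral => x _; rewrite /= powR_mulrn// real_normK// num_real.
Qed.

Section sample_mean.
Context d (T : measurableType d) (R : realType) (P : probability T R).
Context (X : nat -> {RV P >-> R}).
Context (X_indep : mutually_independent X).
Context (X_ident : forall j (A : set R), measurable A ->
  distribution P (X j) A = distribution P (X 0) A).

Lemma pairwise_independent i j (A B : set R) :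
  i <> j -> measurable A -> measurable B ->
  P (X i @^-1` A `&` X j @^-1` B) = P (X i @^-1` A) * P (X j @^-1` B).
Proof.
move=> /eqP ij mA mB.
have := X_indep (J := [:: i; j]) (A := fun k => if k == i then A else B).
rewrite /= inE ij big_cons big_seq1 eqxx eq_sym (negbTE ij) => /(_ isT) <-.
  congr (P _); apply/seteqP; split => w /=.
    move=> [Aw Bw] k; rewrite /= !inE => /orP[/eqP ->|/eqP ->]; first by rewrite eqxx.
    by rewrite eq_sym (negbTE ij).
  move=> H; split; first by have := H i; rewrite /= !inE eqxx; apply.
  have := H j; rewrite /= !inE eqxx orbT eq_sym (negbTE ij); exact.
by move=> k; case: ifP.
Qed.

Lemma ge0_integral_ident j (G : R -> \bar R) :
  measurable_fun [set: R] G -> (forall x, 0 <= G x) ->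
  \int[P]_w G (X j w) = \int[P]_w G (X 0 w).
Proof.
move=> mG G0; rewrite -(ge0_integral_distribution (X j))//.
rewrite -(ge0_integral_distribution (X 0))//.
by apply: eq_measure_integral => A mA _; exact: X_ident.
Qed.

Lemma integral_ident j (G : R -> \bar R) : measurable_fun [set: R] G ->
  \int[P]_w G (X j w) = \int[P]_w G (X 0 w).
Proof.
move=> mG; rewrite integralE [RHS]integralE; congr (_ - _).
- transitivity (\int[P]_w G^\+ (X j w)).
    by apply: eq_integral => w _; rewrite !funeposE.
  rewrite ge0_integral_ident//; last exact: measurable_funepos.
  by apply: eq_integral => w _; rewrite !funeposE.
- transitivity (\int[P]_w G^\- (X j w)).
    by apply: eq_integral => w _; rewrite !funenegE.
  rewrite ge0_integral_ident//; last exact: measurable_funeneg.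
  by apply: eq_integral => w _; rewrite !funenegE.
Qed.

(** When the second moment is finite, the left-hand side is the variance of the
    sample mean, which is 1/n times a variance, and a variance is at most the
    second moment.  When it is infinite, so is the right-hand side; the
    subtracted mean may then be a default value. *)
Lemma sample_mean_variance_le (phi : R -> R) n :
  (0 < n)%N -> measurable_fun [set: R] phi ->
  \int[P]_w ((n%:R^-1 * \sum_(j < n) phi (X j w)
               - fine (\int[P]_w (phi (X 0 w))%:E)) ^+ 2)%:E <=
  (n%:R^-1)%:E * \int[P]_w (phi (X 0 w) ^+ 2)%:E.
Proof.
move=> n0 mphi.
have ninv : (0 < (n%:R^-1 : R))%R by rewrite invr_gt0 ltr0n.
have mphi2 : measurable_fun [set: R] (fun x => (phi x ^+ 2)%:E).
  by apply/measurable_EFinP; exact: measurable_funX.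
have [->|fin2] := eqVneq (\int[P]_w (phi (X 0 w) ^+ 2)%:E) +oo.
  by rewrite gt0_muley ?lte_fin// leey.
have mZ j : measurable_fun [set: T] (phi \o X j) by exact: measurableT_comp.
pose Z j : {RV P >-> R} := HB.pack (phi \o X j) (isMeasurableFun.Build _ _ _ _ _ (mZ j)).
have ZE j : 'E_P[Z j] = 'E_P[Z 0%N].
  rewrite unlock; apply: (@integral_ident j (EFin \o phi)).
  exact/measurable_EFinP.
have Z2E j : 'E_P[(Z j : T -> R) ^+ 2] = \int[P]_w (phi (X 0 w) ^+ 2)%:E.
  rewrite unlock; apply: (@ge0_integral_ident j (fun x => (phi x ^+ 2)%:E)) => //.
  by move=> x; rewrite lee_fin sqr_ge0.
have Z2 j : (Z j : T -> R) \in Lfun P 2%:E.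
  apply: Lfun2_integral_sqr => //.
  have := Z2E j; rewrite unlock => ->.
  by rewrite lt_neqAle fin2 leey.
have Pfin : P setT \is a fin_num by rewrite fin_num_measure.
have Z1 j : (Z j : T -> R) \in Lfun P 1 by exact: Lfun_subset12.
have covZ i j : i <> j -> covariance P (Z i) (Z j) = 0.
  move=> ij; have ZZ1 := Lfun2_mul_Lfun1 (Z2 i) (Z2 j).
  rewrite covarianceE// independent_expectationM//.
    by rewrite subee// fin_numM// expectation_fin_num.
  move=> A B mA mB; have := @pairwise_independent i j (phi @^-1` A) (phi @^-1` B) ij.
  by apply; rewrite -[X in measurable X]setTI; exact: mphi.
have sumZ2 m : (\sum_(j < m) (Z j : T -> R))%R \in Lfun P 2%:E.
  by rewrite rpred_sum ?lee1n// => j _; exact: Z2.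
pose S : T -> R := (\sum_(j < n) (Z j : T -> R))%R.
have S2 : S \in Lfun P 2%:E by exact: sumZ2.
have SE : 'E_P[n%:R^-1 \o* S] = 'E_P[Z 0%N].
  rewrite expectationZl; last exact: Lfun_subset12.
  rewrite (_ : 'E_P[S] = n%:R%:E * 'E_P[Z 0%N]).
    by rewrite muleA -EFinM mulVf ?mul1e// pnatr_eq0 -lt0n.
  rewrite /S; elim: (n) => [|m IH].
    by rewrite big_ord0 mul0e expectation_cst.
  rewrite big_ord_recr/= expectationD; [|exact/Lfun_subset12/sumZ2|exact: Z1].
  rewrite IH (ZE m) -natr1 EFinD muleDl ?mul1e// ?expectation_fin_num//.
  exact: Z1.
(* The mean of the sample mean is that of Z 0, so the integrand is the centred square. *)
rewrite [leLHS](_ : _ = 'V_P[n%:R^-1 \o* S]); last first.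
  rewrite /variance covariance.unlock SE expectation.unlock.
  apply: eq_integral => w _; congr EFin; rewrite expr2.
  have -> : (n%:R^-1 * \sum_(j < n) phi (X j w))%R = (n%:R^-1 \o* S)%R w.
    by rewrite /= mulrC /S fct_sumE.
  by [].
rewrite varianceZ// (variance_sum_uncorrelated n Z2 covZ).
rewrite expr2 EFinM -muleA lee_wpmul2l ?lee_fin ?(ltW ninv)//.
have V_le j : 'V_P[Z j] <= \int[P]_w (phi (X 0 w) ^+ 2)%:E.
  by rewrite varianceE// Z2E -[leRHS]sube0 leeB// sqre_ge0.
apply: (@le_trans _ _ ((n%:R^-1)%:E * \sum_(j < n) \int[P]_w (phi (X 0 w) ^+ 2)%:E)).
  by rewrite lee_wpmul2l ?lee_fin ?(ltW ninv)//; apply: lee_sum => j _.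
have Ifin : \int[P]_w (phi (X 0 w) ^+ 2)%:E \is a fin_num.
  rewrite ge0_fin_numE ?lt_neqAle ?fin2 ?leey//.
  by apply: integral_ge0 => w _; rewrite lee_fin sqr_ge0.
rewrite -(fineK Ifin) sumEFin sumr_const card_ord -EFinM lee_fin.
by rewrite -[X in (_ * X)%R]mulr_natl mulrA mulVf ?mul1r// pnatr_eq0 -lt0n.
Qed.

End sample_mean.

(** * Weighted square integrals *)

Lemma integral_oneDsqrV_lty (R : realType) :
  \int[@lebesgue_measure R]_x ((1 + x ^+ 2)^-1)%:E < +oo.
Proof.
rewrite ge0_symfun_integralT//.
- have := @integral0y_oneDsqr R; rewrite set_itvE => ->.
  by rewrite -EFinM ltry.
- by move=> x; rewrite invr_ge0 addr_ge0// sqr_ge0.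
- exact: continuous_oneDsqrV.
- by move=> x; rewrite /= sqrrN.
Qed.

Section weighted_bound.
Context d (T : measurableType d) (R : realType) (P : probability T R).
Context (Y : {RV P >-> R}) (K : R -> R) (h : R).
Context (h0 : (0 < h)%R) (h1 : (h <= 1)%R) (mK : measurable_fun [set: R] K).
Local Notation mu := (@lebesgue_measure R).

Lemma measurable_weight : measurable_fun [set: R] (fun x : R => 1 + x ^+ 2)%R.
Proof. by apply: measurable_funD => //; exact: measurable_funX. Qed.

(** The substitution x = h u + y.  The factor h^-2 in the square of the dilated
    kernel is absorbed by the explicit h and by dx = h du. *)
Lemma integral_weighted_dilate_sqr y :
  \int[mu]_x ((1 + x ^+ 2) * (h * dilate h K (x - y) ^+ 2))%:E =
  \int[mu]_u ((1 + (h * u + y) ^+ 2) * K u ^+ 2)%:E.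
Proof.
pose G x := ((1 + x ^+ 2) * (h * dilate h K (x - y) ^+ 2))%:E.
have mG : measurable_fun [set: R] G.
  apply/measurable_EFinP; apply: measurable_funM; first exact: measurable_weight.
  apply: measurable_funM => //; apply: measurable_funX.
  by apply: (measurableT_comp (measurable_dilate h mK)); exact: measurable_funB.
have hne : h != 0%R by rewrite gt_eqF.
have G0 x : 0 <= G x.
  by rewrite lee_fin mulr_ge0 ?addr_ge0 ?sqr_ge0// mulr_ge0 ?sqr_ge0// ltW.
have aff := ge0_integral_affine y hne mG G0.
transitivity (h%:E * \int[mu]_u G (h * u + y)%R).
  by rewrite aff muleA -EFinM gtr0_norm// mulfV// mul1e.
rewrite -ge0_integralZl//; last 2 first.
- by apply: (measurableT_comp mG); exact: measurable_affine.
- by rewrite lee_fin ltW.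
apply: eq_integral => u _; rewrite /G -EFinM /dilate addrK.
by rewrite (mulrC h u) mulfK// (mulrC u h); congr EFin; field.
Qed.

(** This is where h <= 1 enters: (h u)^2 <= u^2. *)
Lemma weight_mul_le (y u : R) :
  (1 + (h * u + y) ^+ 2 <= 2 * (1 + y ^+ 2) * (1 + u ^+ 2))%R.
Proof.
have hu : ((h * u) ^+ 2 <= u ^+ 2)%R.
  by rewrite exprMn ler_piMl ?sqr_ge0// expr_le1// ltW.
have := sqr_ge0 (h * u - y); have := sqr_ge0 y; have := sqr_ge0 u.
have : (0 <= y ^+ 2 * u ^+ 2)%R by rewrite mulr_ge0 ?sqr_ge0.
move: hu; move: (h * u)%R => v; nra.
Qed.

(** Exchanging the integrals makes the substitution possible for each value of
    [Y]; the weight then splits into a factor for [Y] and a factor for u. *)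
Lemma integral_weighted_shift_le :
  \int[mu]_x \int[P]_w ((1 + x ^+ 2) * (h * dilate h K (x - Y w) ^+ 2))%:E <=
  2%:E * (\int[P]_w (1 + Y w ^+ 2)%:E) * \int[mu]_u ((1 + u ^+ 2) * K u ^+ 2)%:E.
Proof.
have mF : measurable_fun [set: measurableTypeR R * T]
    (fun z : measurableTypeR R * T =>
       ((1 + z.1 ^+ 2) * (h * dilate h K (z.1 - Y z.2) ^+ 2))%:E).
  apply/measurable_EFinP; apply: measurable_funM.
    by apply: (measurableT_comp measurable_weight).
  apply: measurable_funM => //; apply: measurable_funX.
  exact: (measurable_shift Y (measurable_dilate h mK)).
have q0 (x : R) : (0 <= 1 + x ^+ 2)%R by rewrite addr_ge0 ?sqr_ge0.
have mq : measurable_fun [set: R] (fun u => ((1 + u ^+ 2) * K u ^+ 2)%:E).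
  apply/measurable_EFinP; apply: measurable_funM; first exact: measurable_weight.
  exact: measurable_funX.
have mY : measurable_fun [set: T] (fun w => (1 + Y w ^+ 2)%:E).
  by apply/measurable_EFinP; apply: (measurableT_comp measurable_weight).
have I0 : 0 <= \int[mu]_u ((1 + u ^+ 2) * K u ^+ 2)%:E.
  by apply: integral_ge0 => u _; rewrite lee_fin mulr_ge0 ?sqr_ge0.
rewrite (fubini_tonelli (fun z : measurableTypeR R * T =>
  ((1 + z.1 ^+ 2) * (h * dilate h K (z.1 - Y z.2) ^+ 2))%:E))//=; last first.
  by move=> z; rewrite lee_fin mulr_ge0// mulr_ge0 ?sqr_ge0// ltW.
rewrite -[X in X * _]ge0_integralZl//; last by move=> w _; rewrite lee_fin.
rewrite -ge0_integralZr//; last 2 first.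
- exact: measurable_funeM.
- by move=> w _; rewrite mule_ge0// lee_fin.
apply: ge0_le_integral => //.
- move=> w _; apply: integral_ge0 => x _.
  by rewrite lee_fin mulr_ge0// mulr_ge0 ?sqr_ge0// ltW.
- apply: (measurable_fun_fubini_tonelli_G (fun z : measurableTypeR R * T =>
    ((1 + z.1 ^+ 2) * (h * dilate h K (z.1 - Y z.2) ^+ 2))%:E)) => //.
  by move=> z; rewrite lee_fin mulr_ge0// mulr_ge0 ?sqr_ge0// ltW.
- by apply: emeasurable_funM => //; exact: measurable_funeM.
move=> w _; rewrite integral_weighted_dilate_sqr -EFinM -ge0_integralZl//; last 2 first.
- by move=> u _; rewrite lee_fin mulr_ge0 ?sqr_ge0.
- by rewrite lee_fin mulr_ge0.
apply: ge0_le_integral => //.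
- by move=> u _; rewrite lee_fin mulr_ge0 ?sqr_ge0.
- apply/measurable_EFinP; apply: measurable_funM; last exact: measurable_funX.
  by apply: (measurableT_comp measurable_weight); exact: measurable_affine.
- exact: measurable_funeM.
move=> u _; rewrite -EFinM lee_fin [leRHS]mulrA ler_wpM2r ?sqr_ge0//.
exact: weight_mul_le.
Qed.

End weighted_bound.

(** * The rate of the L1 deviation *)

Section root_mean_square.
Context d (T : measurableType d) (R : realType) (P : probability T R).
Context (X : nat -> {RV P >-> R}) (f : R -> R).
Context (X_indep : mutually_independent X) (Xf : forall j, has_density (X j) f).
Local Notation mu := (@lebesgue_measure R).

Lemma has_density_ident j (A : set R) : measurable A ->
  distribution P (X j) A = distribution P (X 0) A.
Proof. by move=> mA; have [_ _ ->//] := Xf j; have [_ _ ->] := Xf 0. Qed.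

(** With t = sqrt a |b|, the difference of the two sides is
    (q t - 1)^2 / (2 q). *)
Lemma sqrt_mul_norm_le (a b q : R) : (0 <= a)%R -> (0 < q)%R ->
  (Num.sqrt a * `|b| <= 2^-1 * q * a * b ^+ 2 + 2^-1 * q^-1)%R.
Proof.
move=> a0 q0; set t := (Num.sqrt a * `|b|)%R.
have <- : (2^-1 * q * t ^+ 2 = 2^-1 * q * a * b ^+ 2)%R.
  by rewrite /t exprMn sqr_sqrtr// real_normK ?num_real// mulrA.
have : (0 <= 2^-1 * q^-1 * (q * t - 1) ^+ 2)%R.
  by rewrite mulr_ge0 ?sqr_ge0// mulr_ge0 ?invr_ge0// ltW.
rewrite -subr_ge0; congr (0 <= _)%R; field.
by rewrite gt_eqF.
Qed.

(** Apply [sqrt_mul_norm_le] with weight q = 1 + x^2 and a = n h; the factor n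
    cancels the 1/n in the variance of the sample mean. *)
Lemma expectation_deviation_le (K : R -> R) (h : R) n x :
  (0 < n)%N -> (0 < h)%R -> measurable_fun [set: R] K ->
  \int[P]_w (Num.sqrt (n%:R * h) * `|kernel_estimator X K h n w x -
     convolution f (dilate h K) x|)%:E <=
  (2^-1)%:E * \int[P]_w ((1 + x ^+ 2) * (h * dilate h K (x - X 0 w) ^+ 2))%:E
  + (2^-1)%:E * ((1 + x ^+ 2)^-1)%:E.
Proof.
move=> n0 h0 mK; have mD := measurable_dilate h mK.
have mphi : measurable_fun [set: R] (fun z => dilate h K (x - z)).
  by apply: (measurableT_comp mD); exact: measurable_funB.
have q0 : (0 < 1 + x ^+ 2)%R by rewrite ltr_pwDl ?sqr_ge0.
have nh0 : (0 <= n%:R * h)%R by rewrite mulr_ge0// ltW.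
set q := (1 + x ^+ 2)%R in q0 *.
set c := convolution f (dilate h K) x.
have mdev : measurable_fun [set: T] (fun w => kernel_estimator X K h n w x - c)%R.
  apply: measurable_funB => //.
  exact: (measurable_fun_pair1 x (measurable_estimator X h n mK)).
have mdev2 : measurable_fun [set: T]
    (fun w => ((kernel_estimator X K h n w x - c) ^+ 2)%:E).
  by apply/measurable_EFinP; exact: measurable_funX.
have mg2 : measurable_fun [set: T] (fun w => (dilate h K (x - X 0 w) ^+ 2)%:E).
  by apply/measurable_EFinP; apply: measurable_funX; exact: (measurableT_comp mphi).
have k0 : (0 <= 2^-1 * q * (n%:R * h))%R.
  by rewrite mulr_ge0// mulr_ge0 ?invr_ge0// ltW.
have r0 : (0 <= 2^-1 * q^-1)%R by rewrite mulr_ge0 ?invr_ge0// ltW.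
apply: (@le_trans _ _ (\int[P]_w ((2^-1 * q * (n%:R * h))%:E *
    ((kernel_estimator X K h n w x - c) ^+ 2)%:E + cst (2^-1 * q^-1)%:E w))).
  apply: ge0_le_integral => //.
  - apply/measurable_EFinP; apply: measurable_funM => //.
    exact: measurableT_comp.
  - by apply: emeasurable_funD => //; exact: measurable_funeM.
  by move=> w _; rewrite -EFinM -EFinD lee_fin sqrt_mul_norm_le.
rewrite ge0_integralD//; last 2 first.
- by move=> w _; rewrite -EFinM lee_fin mulr_ge0 ?sqr_ge0.
- exact: measurable_funeM.
rewrite integral_cst//= probability_setT mule1 (EFinM _ q^-1) leeD2r//.
rewrite ge0_integralZl//; last by move=> w _; rewrite lee_fin sqr_ge0.
have -> : \int[P]_w (q * (h * dilate h K (x - X 0 w) ^+ 2))%:E =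
    (q * h)%:E * \int[P]_w (dilate h K (x - X 0 w) ^+ 2)%:E.
  rewrite -ge0_integralZl//; last 2 first.
  - by move=> w _; rewrite lee_fin sqr_ge0.
  - by rewrite lee_fin mulr_ge0// ltW.
  by apply: eq_integral => w _; rewrite -EFinM mulrA.
have := sample_mean_variance_le X_indep has_density_ident n0 mphi.
rewrite -(convolution_expectation (Xf 0) x mD) => var_le.
rewrite muleA -EFinM.
apply: (@le_trans _ _ ((2^-1 * q * (n%:R * h))%:E *
    ((n%:R^-1)%:E * \int[P]_w (dilate h K (x - X 0 w) ^+ 2)%:E))).
  by rewrite lee_wpmul2l// lee_fin.
rewrite muleA -EFinM le_eqVlt; apply/orP; left; apply/eqP; congr (_%:E * _).
by field; rewrite pnatr_eq0 -lt0n.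
Qed.

(** A bound that depends neither on n nor on h.  The two integrals are
    exchanged first, since the variance estimate is pointwise in x. *)
Lemma sqrt_L1_deviation_le (K : R -> R) (h : R) n :
  (0 < n)%N -> (0 < h)%R -> (h <= 1)%R -> measurable_fun [set: R] K ->
  (Num.sqrt (n%:R * h))%:E * L1_deviation X f K h n <=
  \int[P]_w (1 + X 0 w ^+ 2)%:E * \int[mu]_u ((1 + u ^+ 2) * K u ^+ 2)%:E +
  (2^-1)%:E * \int[mu]_x ((1 + x ^+ 2)^-1)%:E.
Proof.
move=> n0 h0 h1 mK; have mD := measurable_dilate h mK.
have mdev := measurable_deviation Xf h n mK.
have q0 (x : R) : (0 < 1 + x ^+ 2)%R by rewrite ltr_pwDl ?sqr_ge0.
have mqV : measurable_fun [set: R] (fun x : R => ((1 + x ^+ 2)^-1)%:E).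
  apply/measurable_EFinP; apply: continuous_measurable_fun.
  exact: continuous_oneDsqrV.
have mF : measurable_fun [set: T * measurableTypeR R]
    (fun z : T * measurableTypeR R => (Num.sqrt (n%:R * h) *
      `|kernel_estimator X K h n z.1 z.2 - convolution f (dilate h K) z.2|)%:E).
  by apply/measurable_EFinP; exact: measurable_funM.
pose G (x : measurableTypeR R) := \int[P]_w
  ((1 + x ^+ 2) * (h * dilate h K (x - X 0 w) ^+ 2))%:E.
have G0 x : 0 <= G x.
  apply: integral_ge0 => w _; rewrite lee_fin mulr_ge0//; first exact: ltW.
  by rewrite mulr_ge0 ?sqr_ge0// ltW.
have mG : measurable_fun [set: measurableTypeR R] G.
  apply: (measurable_integral_EFin _ (F := fun z : measurableTypeR R * T =>
    (1 + z.1 ^+ 2) * (h * dilate h K (z.1 - X 0 z.2) ^+ 2))%R).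
  apply: measurable_funM; first exact: (measurableT_comp (@measurable_weight R)).
  apply: measurable_funM => //; apply: measurable_funX.
  exact: (measurable_shift (X 0) mD).
have -> : (Num.sqrt (n%:R * h))%:E * L1_deviation X f K h n =
    \int[mu]_x \int[P]_w (Num.sqrt (n%:R * h) * `|kernel_estimator X K h n w x -
      convolution f (dilate h K) x|)%:E.
  rewrite -(fubini_tonelli (fun z : T * measurableTypeR R => (Num.sqrt (n%:R * h) *
      `|kernel_estimator X K h n z.1 z.2 - convolution f (dilate h K) z.2|)%:E))//=.
  rewrite /L1_deviation -ge0_integralZl//; last 2 first.
  - exact: measurable_integral_deviation.
  - by move=> w _; exact: integral_ge0.
  apply: eq_integral => w _; rewrite -ge0_integralZl//.
  by apply/measurable_EFinP; exact: (measurable_fun_pair2 w mdev).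
apply: (@le_trans _ _ (\int[mu]_x ((2^-1)%:E * G x +
    (2^-1)%:E * ((1 + x ^+ 2)^-1)%:E))).
  apply: ge0_le_integral => //.
  - move=> x _; apply: integral_ge0 => w _.
    by rewrite lee_fin mulr_ge0 ?sqrtr_ge0.
  - exact: (measurable_fun_fubini_tonelli_G _ mF).
  - by apply: emeasurable_funD; exact: measurable_funeM.
  by move=> x _; exact: expectation_deviation_le.
rewrite ge0_integralD//; last 4 first.
- by move=> x _; rewrite mule_ge0.
- exact: measurable_funeM.
- by move=> x _; rewrite -EFinM lee_fin mulr_ge0 ?invr_ge0// ltW.
- exact: measurable_funeM.
rewrite [X in _ + X <= _]ge0_integralZl//; last first.
  by move=> x _; rewrite lee_fin invr_ge0 ltW.
rewrite leeD2r// ge0_integralZl//.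
have := integral_weighted_shift_le (X 0) h0 h1 mK; rewrite -/G => Gle.
apply: (@le_trans _ _ ((2^-1)%:E * (2%:E * \int[P]_w (1 + X 0 w ^+ 2)%:E *
    \int[mu]_u ((1 + u ^+ 2) * K u ^+ 2)%:E))).
  by rewrite lee_wpmul2l// lee_fin invr_ge0.
by rewrite !muleA -EFinM mulVf// mul1e.
Qed.

End root_mean_square.

(** * Kernel density estimates *)

Theorem mainTheorem4 (R : realType) (d : measure_display) (T : measurableType d)
    (P : probability T R) (s : nat) (h : nat -> R) (X : nat -> {RV P >-> R})
    (f K0 Ks : R -> R)
    (s_ge1 : (1 <= s)%N)
    (h_range : forall n, (1 <= n)%N -> (0 < h n <= 1)%R)
    (h_cvg0 : h n @[n --> \oo] --> (0 : R)%R)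
    (X_indep : mutually_independent X)
    (X_density : forall j, has_density (X j) f)
    (K0_B : in_B s K0) (Ks_B : in_B s Ks)
    (K0_alpha0 : alpha 0 K0 = 1)
    (K0_alpha : forall j, (1 <= j <= s)%N -> alpha j K0 = 0)
    (Ks_alpha : forall j, (j < s)%N -> alpha j Ks = 0)
    (Ks_alphas : alpha s Ks = 1) :
  let K n : R -> R := fun t => (K0 t + h n * Ks t)%R in
  let mu := @lebesgue_measure R in
  (forall n, (1 <= n)%N ->
     L1_deviation X f (K n) (h n) n <=
       L1_deviation X f K0 (h n) n
       + (2 * h n)%:E * (\int[mu]_x `|f x|%:E * \int[mu]_t `|Ks t|%:E))
  /\
  (\int[mu]_x (x ^+ 2 * f x)%:E < +oo ->
   \int[mu]_t ((1 + t ^+ 2) * K0 t ^+ 2)%:E < +oo ->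
   (exists c : R, forall n, (1 <= n)%N -> (n%:R * h n ^+ 3 <= c)%R) ->
   exists C : R, \forall n \near \oo,
     (Num.sqrt (n%:R * h n))%:E * L1_deviation X f (K n) (h n) n <= C%:E).
Proof.
move=> K mu.
have [mK0 _] := K0_B; have [mKs _] := Ks_B.
have iK0 := in_B_integral K0_B; have iKs := in_B_integral Ks_B.
have dev_le n : (1 <= n)%N -> L1_deviation X f (K n) (h n) n <=
    L1_deviation X f K0 (h n) n + (2 * h n)%:E * \int[mu]_t `|Ks t|%:E.
  move=> n1; have /andP[hn0 hn1] := h_range n n1.
  by apply: L1_deviationD_le => //; exact: ltW.
split=> [n n1|fvar K0sqr [c hc]].
  by rewrite (integral_density X_density) mul1e; exact: dev_le.
have c0 : (0 <= c)%R.
  apply: le_trans (hc 1%N isT); have /andP[? _] := h_range 1%N isT.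
  by rewrite mulr_ge0// exprn_ge0// ltW.
have Y2fin : \int[P]_w (1 + X 0%N w ^+ 2)%:E < +oo.
  have msq : measurable_fun [set: R] (fun y : R => (y ^+ 2)%:E).
    by apply/measurable_EFinP; exact: measurable_funX.
  under eq_integral do rewrite EFinD.
  rewrite ge0_integralD//; last 2 first.
  - by move=> w _; rewrite lee_fin sqr_ge0.
  - exact: (measurableT_comp msq).
  rewrite (ge0_expectation_density (X_density 0%N) msq); last first.
    by move=> y; rewrite lee_fin sqr_ge0.
  rewrite lte_add_pinfty//.
  by rewrite integral_cst//= probability_setT mule1 ltry.
have Y20 : 0 <= \int[P]_w (1 + X 0%N w ^+ 2)%:E.
  by apply: integral_ge0 => w _; rewrite lee_fin addr_ge0 ?sqr_ge0.
have K20 : 0 <= \int[mu]_t ((1 + t ^+ 2) * K0 t ^+ 2)%:E.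
  by apply: integral_ge0 => w _; rewrite lee_fin mulr_ge0 ?addr_ge0 ?sqr_ge0.
(* B0 bounds the contribution of K0; B1 bounds that of Ks, because
   sqrt (n h) h = sqrt (n h^3) is at most sqrt c. *)
pose B0 := \int[P]_w (1 + X 0%N w ^+ 2)%:E * \int[mu]_t ((1 + t ^+ 2) * K0 t ^+ 2)%:E +
  (2^-1)%:E * \int[mu]_x ((1 + x ^+ 2)^-1)%:E.
have V0 : 0 <= \int[mu]_x ((1 + x ^+ 2)^-1)%:E.
  by apply: integral_ge0 => x _; rewrite lee_fin invr_ge0 addr_ge0 ?sqr_ge0.
have B0fin : B0 < +oo.
  rewrite lte_add_pinfty//.
    by rewrite lte_mul_pinfty// ge0_fin_numE.
  by rewrite lte_mul_pinfty//; exact: integral_oneDsqrV_lty.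
pose B1 := (2 * Num.sqrt c)%:E * \int[mu]_t `|Ks t|%:E.
have Is0 : 0 <= \int[mu]_t `|Ks t|%:E by exact: integral_ge0.
have B1fin : B1 < +oo.
  by rewrite lte_mul_pinfty// lee_fin mulr_ge0// sqrtr_ge0.
have B00 : 0 <= B0 by rewrite adde_ge0// mule_ge0.
have B10 : 0 <= B1 by rewrite mule_ge0// lee_fin mulr_ge0// sqrtr_ge0.
exists (fine (B0 + B1)).
near=> n.
have n1 : (1 <= n)%N by near: n; exact: nbhs_infty_ge.
have /andP[hn0 hn1] := h_range n n1.
have BB0 : 0 <= B0 + B1 by exact: adde_ge0.
have BBfin : B0 + B1 < +oo by exact: lte_add_pinfty.
rewrite fineK ?ge0_fin_numE//.
have s0 : (0 <= Num.sqrt (n%:R * h n))%R by exact: sqrtr_ge0.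
apply: (@le_trans _ _ ((Num.sqrt (n%:R * h n))%:E *
    (L1_deviation X f K0 (h n) n + (2 * h n)%:E * \int[mu]_t `|Ks t|%:E))).
  by rewrite lee_wpmul2l ?lee_fin//; exact: dev_le.
rewrite ge0_muleDr//; last 2 first.
- by apply: integral_ge0 => w _; exact: integral_ge0.
- by rewrite mule_ge0// lee_fin mulr_ge0// ltW.
apply: leeD; first exact: sqrt_L1_deviation_le.
rewrite muleA -EFinM lee_wpmul2r// lee_fin mulrCA ler_wpM2l//.
have -> : (Num.sqrt (n%:R * h n) * h n = Num.sqrt (n%:R * h n ^+ 3))%R.
  rewrite (exprS (h n) 2) mulrA [RHS]sqrtrM ?mulr_ge0// ?ltW//.
  by rewrite sqrtr_sqr gtr0_norm.
by rewrite ler_wsqrtr// hc.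
Unshelve. all: by end_near.
Qed.
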